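(* Let $a \geq b > 0$, and let $\{a_n\}_{n\ge 0}$ and $\{b_n\}_{n\ge 0}$ be the sequences of positive real numbers satisfying $a_0=a$, $b_0=b$ and $$a_{n+1}=\sqrt{\frac{a_n^2+3b_n^2}{4}},\qquad b_{n+1}=\sqrt[4]{\frac{(a_n^2+b_n^2)b_n^2}{2}},\qquad n=0,1,2,\ldots.$$ Then both sequences converge to the same limit as $n\to\infty$; denote this limit by $M_4(a,b)$. Moreover, $\pi_4$ can be represented as $$\pi_4=\frac{2M_4\left(1,\frac{1}{\sqrt[4]{2}}\right)^2}{1-\sum_{n=1}^\infty 2^{n+1}\sqrt{a_n^4-b_n^4}},$$ where in this formula $\{a_n\}$ and $\{b_n\}$ are the sequences satisfying $a_{n+1}=\sqrt{\frac{a_n^2+3b_n^2}{4}}$ and $b_{n+1}=\sqrt[4]{\frac{(a_n^2+b_n^2)b_n^2}{2}}$ for $n=0,1,2,\ldots$, with $a_0=a=1$ and $b_0=b=1/\sqrt[4]{2}$.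
   Context: The constant $\pi_4$ is defined by $$\pi_4:=2\int_0^1\frac{dt}{(1-t^4)^{1/4}}=\frac{2\pi}{4\sin(\pi/4)}.$$ *)

(* Defs.v *)
From Stdlib Require Import Reals Lra.
From Coquelicot Require Import Coquelicot.
Local Open Scope R_scope.

(* [Rpower x y] is [exp (y * ln x)], the usual real power for [0 < x] only;
   every fourth root below is taken of a positive number. *)
Definition root4 (x : R) : R := Rpower x (/ 4).

(* The integrand is singular at 1, so the integral is improper there. *)
Definition pi4 : R :=
  2 * RInt_gen (fun t : R => / root4 (1 - t ^ 4)) (at_point 0) (at_left 1).

Fixpoint mean4 (a b : R) (n : nat) : R * R :=
  match n with
  | O => (a, b)
  | S m =>
      let (x, y) := mean4 a b m in
      (sqrt ((x ^ 2 + 3 * y ^ 2) / 4),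
       root4 ((x ^ 2 + y ^ 2) * y ^ 2 / 2))
  end.

Definition mean4_a (a b : R) (n : nat) : R := fst (mean4 a b n).
Definition mean4_b (a b : R) (n : nat) : R := snd (mean4 a b n).

Definition M4 (a b : R) : R := real (Lim_seq (mean4_a a b)).

Lemma mean4_pos (a b : R) (n : nat) :
  0 < a -> 0 < b -> 0 < mean4_a a b n /\ 0 < mean4_b a b n.
Proof.
intros Ha Hb; unfold mean4_a, mean4_b.
induction n as [|n IH]; simpl; [now split|].
destruct (mean4 a b n) as [x y]; simpl in *; destruct IH as [Hx Hy].
split; [|apply exp_pos].
apply sqrt_lt_R0; nra.
Qed.

Definition defect_term (a b : R) (n : nat) : R :=
  2 ^ (n + 1) * sqrt (mean4_a a b n ^ 4 - mean4_b a b n ^ 4).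

(* Main.v *)
Require Import Defs.
From Stdlib Require Import Reals Lra.
From Coquelicot Require Import Coquelicot.
Local Open Scope R_scope.

(** Write x = a_n^2, y = b_n^2, c = sqrt (x^2 - y^2) and D(t) = x + c cos t, and
    let K and E be the integrals over [0, PI] of 1 / sqrt D and of sqrt D.  One
    step of the iteration replaces x by (x + 3 y) / 4 and c by (x - y) / 4, and
    this is exactly Landen's transformation of K and E (if x = (A^2 + B^2) / 2
    and y = A B, it is one step of the arithmetic-geometric mean of A and B).
    The Landen substitution gives
      K' = K  ([ellK_landen])   and   2 E' = E + y K  ([ellE_landen]).

    Since c tends to 0, the invariance of K identifies the limit of the means:
    K = PI / M4 ([ellK_M4]).  The second relation says that T = x K - E satisfies
    T = (x - y) K / 2 + 2 T'.  The n-th term of the series is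
    2^(n+1) c_n = 2^(n-1) (x_(n-1) - y_(n-1)), so the series telescopes to
    2 (x_0 - E_0 / K) ([is_series_defect]).  For x_0 = 1 the denominator in the
    formula for pi4 is therefore (2 E - K) / K, and the right-hand side is
    2 PI^2 / (2 K E - K^2).

    The starting value b = 1 / root4 2 gives c_0 = 1 / sqrt 2, the modulus that
    is its own complement, and there Legendre's relation reads
    2 K E - K^2 = 2 sqrt 2 PI ([legendre_self_complementary]).  It is proved as
    usual: the combination K(u) E(v) + E(u) K(v) - K(u) K(v) with u = sin s and
    v = cos s has derivative 0 in s, and its limit as s tends to 0 is
    K(0) E(1) = PI * 2 sqrt 2.

    So the right-hand side is PI / sqrt 2.  The integral defining pi4 has the
    same value, by the substitution s = t / root4 (1 - t^4), which turns it into
    twice the integral of 1 / (1 + s^4) over the half-line ([pi4_eq]). *)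

(** * Integrals of functions of x + c cos t *)

Definition cosint (g : R -> R) (x c : R) : R :=
  RInt (fun t => g (x + c * cos t)) 0 PI.

(** With x = (A^2 + B^2) / 2 and c = (A^2 - B^2) / 2, the radicand is
    A^2 cos^2 (t/2) + B^2 sin^2 (t/2), so these are twice the complete elliptic
    integrals of the first and second kinds for the arithmetic-geometric mean
    of A and B.  The parameters x and c are kept because one step of the
    iteration makes them (x + 3 y) / 4 and (x - y) / 4, where
    y = sqrt (x^2 - c^2) = A B. *)
Definition ellK (x c : R) : R := cosint (fun z => / sqrt z) x c.
Definition ellE (x c : R) : R := cosint sqrt x c.

Lemma radicand_bounds (x c t : R) :
  0 <= c -> x - c <= x + c * cos t <= x + c.
Proof. intros Hc; pose proof (COS_bound t); nra. Qed.

Lemma radicand_pos (x c t : R) : 0 <= c < x -> 0 < x + c * cos t.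
Proof. intros Hc; pose proof (radicand_bounds x c t); lra. Qed.

Lemma continuous_radicand (x c t : R) :
  continuous (fun s => x + c * cos s) t.
Proof. apply (ex_derive_continuous (V := R_NormedModule)); auto_derive; auto. Qed.

Lemma continuous_sqrt_inv (z : R) : 0 < z -> continuous (fun z => / sqrt z) z.
Proof.
intros Hz; apply (ex_derive_continuous (V := R_NormedModule)).
pose proof (sqrt_lt_R0 z Hz); auto_derive; repeat split; auto; lra.
Qed.

Lemma ex_cosint (g : R -> R) (x c : R) :
  0 <= c < x -> (forall z, 0 < z -> continuous g z) ->
  ex_RInt (fun t => g (x + c * cos t)) 0 PI.
Proof.
intros Hc Hg; apply (ex_RInt_continuous (V := R_CompleteNormedModule)).
intros t _.
apply (continuous_comp (fun s => x + c * cos s) g).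
- apply continuous_radicand.
- apply Hg, radicand_pos, Hc.
Qed.

Lemma is_RInt_ellK (x c : R) :
  0 <= c < x -> is_RInt (fun t => / sqrt (x + c * cos t)) 0 PI (ellK x c).
Proof.
intros Hc; apply (RInt_correct (V := R_CompleteNormedModule)).
apply (ex_cosint (fun z => / sqrt z)); auto using continuous_sqrt_inv.
Qed.

Lemma is_RInt_ellE (x c : R) :
  0 <= c < x -> is_RInt (fun t => sqrt (x + c * cos t)) 0 PI (ellE x c).
Proof.
intros Hc; apply (RInt_correct (V := R_CompleteNormedModule)).
apply (ex_cosint sqrt); auto using continuous_sqrt.
Qed.

Lemma cosint_unfold_two_pi (g : R -> R) (x c : R) :
  0 <= c < x -> (forall z, 0 < z -> continuous g z) ->
  RInt (fun t => g (x + c * cos t)) 0 (2 * PI) = 2 * cosint g x c.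
Proof.
intros Hc Hg.
set (f := fun t => g (x + c * cos t)).
assert (Hcont : forall t, continuous f t).
{ intros t; apply (continuous_comp (fun s => x + c * cos s) g).
  - apply continuous_radicand.
  - apply Hg, radicand_pos, Hc. }
assert (Hex : forall a b, ex_RInt f a b).
{ intros a b; apply (ex_RInt_continuous (V := R_CompleteNormedModule)); auto. }
rewrite <- (RInt_Chasles (V := R_CompleteNormedModule) f 0 PI (2 * PI)) by auto.
assert (Hex' : forall a b,
  ex_RInt (fun t => scal (-1) (f (-1 * t + 2 * PI))) a b).
{ intros a b; apply (ex_RInt_continuous (V := R_CompleteNormedModule)); intros t _.
  apply (continuous_scal_r (V := R_NormedModule)).
  apply (continuous_comp (fun s => -1 * s + 2 * PI) f); auto.
  apply (ex_derive_continuous (V := R_NormedModule)); auto_derive; auto. }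
(* The second half of the period is the mirror image, t -> 2 PI - t, of the
   first. *)
assert (Hrefl : RInt f PI (2 * PI) = cosint g x c).
{ pose proof (RInt_comp_lin (V := R_CompleteNormedModule) f (-1) (2 * PI) PI 0
    (Hex _ _)) as H.
  replace (-1 * PI + 2 * PI) with PI in H by ring.
  replace (-1 * 0 + 2 * PI) with (2 * PI) in H by ring.
  rewrite <- H, <- (opp_RInt_swap (V := R_CompleteNormedModule)).
  - unfold cosint; rewrite <- (RInt_opp (V := R_CompleteNormedModule)).
    + apply RInt_ext; intros t _.
      unfold f, opp, scal; simpl; unfold mult; simpl.
      replace (cos (-1 * t + 2 * PI)) with (cos t).
      * ring.
      * replace (-1 * t + 2 * PI) with (2 * PI - t) by ring.
        rewrite cos_minus, cos_2PI, sin_2PI; ring.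
    + apply Hex'.
  - apply Hex'. }
rewrite Hrefl; unfold plus; simpl; fold (cosint g x c).
unfold f; fold (cosint g x c); ring.
Qed.

(** * The Landen transformation *)

(** Landen's amplitude is phi + atan ((B / A) tan phi), with phi = t / 2.  This
    is its double, written with an arctangent whose argument never has a pole,
    so that it is smooth on the whole of [0, PI] and runs over a full period. *)
Definition landen_angle (x c y t : R) : R :=
  2 * t - 2 * atan (c * sin t / (x + y + c * cos t)).


(** With N = c sin t and F = x + y + c cos t, the relation c^2 = (x - y) (x + y)
    makes both F^2 + N^2 and the numerator of the derivative of atan (N / F)
    multiples of x + y; the quotient is (D - y) / (2 D), where D = x + c cos t. *)
Lemma is_derive_landen_angle (x c y t : R) :
  0 <= c < x -> 0 < y -> y ^ 2 = x ^ 2 - c ^ 2 ->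
  is_derive (landen_angle x c y) t (1 + y / (x + c * cos t)).
Proof.
intros Hc Hy Hyc.
pose proof (radicand_pos x c t Hc) as HD.
assert (Hs : sin t * sin t = 1 - cos t * cos t).
{ pose proof (sin2_cos2 t) as H; unfold Rsqr in H; lra. }
assert (HNF : (c * sin t) ^ 2 + (x + y + c * cos t) ^ 2
              = 2 * (x + y) * (x + c * cos t)).
{ replace ((c * sin t) ^ 2) with (c ^ 2 * (sin t * sin t)) by ring.
  rewrite Hs; nra. }
assert (HNF0 : 0 < 2 * (x + y) * (x + c * cos t)).
{ apply Rmult_lt_0_compat; lra. }
unfold landen_angle; auto_derive; [lra|].
replace (1 + c * sin t * / (x + y + c * cos t) *
     (c * sin t * / (x + y + c * cos t) * 1))
  with (2 * (x + y) * (x + c * cos t) / (x + y + c * cos t) ^ 2)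
  by (rewrite <- HNF; field; lra).
replace (c * (1 * cos t) * / (x + y + c * cos t) +
     c * sin t *
     (- (c * (1 * - sin t)) * / ((x + y + c * cos t) * (x + y + c * cos t))))
  with ((x + y) * (x + c * cos t - y) / (x + y + c * cos t) ^ 2).
- field; lra.
- replace ((x + y) * (x + c * cos t - y))
    with (c * cos t * (x + y + c * cos t) + c ^ 2 * (sin t * sin t))
    by (rewrite Hs; nra).
  field; lra.
Qed.

(** The new radicand is a square divided by the old one.  This is what makes
    both square-root integrands below collapse to combinations of the old
    ones. *)
Lemma landen_radicand (x c y t : R) :
  0 <= c < x -> 0 < y -> y ^ 2 = x ^ 2 - c ^ 2 ->
  (x + 3 * y) / 4 + (x - y) / 4 * cos (landen_angle x c y t)
  = (x + c * cos t + y) ^ 2 / (4 * (x + c * cos t)).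
Proof.
intros Hc Hy Hyc.
pose proof (radicand_pos x c t Hc) as HD.
assert (Hs : sin t * sin t = 1 - cos t * cos t).
{ pose proof (sin2_cos2 t) as H; unfold Rsqr in H; lra. }
set (F := x + y + c * cos t).
assert (HF : 0 < F) by (unfold F; lra).
set (N := c * sin t).
assert (HNF : F ^ 2 + N ^ 2 = 2 * (x + y) * (x + c * cos t)).
{ unfold F, N; replace ((c * sin t) ^ 2) with (c ^ 2 * (sin t * sin t)) by ring.
  rewrite Hs; nra. }
assert (HNF0 : 0 < 2 * (x + y) * (x + c * cos t)).
{ apply Rmult_lt_0_compat; lra. }
set (al := atan (N / F)).
set (r := sqrt (1 + (N / F)²)).
assert (Hr2 : r ^ 2 = (F ^ 2 + N ^ 2) / F ^ 2).
{ unfold r; rewrite pow2_sqrt.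
  - unfold Rsqr; field; lra.
  - pose proof (Rle_0_sqr (N / F)); lra. }
assert (Hr : 0 < r).
{ apply sqrt_lt_R0; pose proof (Rle_0_sqr (N / F)); lra. }
(* The new angle is 2 (t - al), and F r is the length of the vector (F, N). *)
assert (Hcos : cos (t - al) = ((x + y) * cos t + c) / (F * r)).
{ rewrite cos_minus; unfold al; rewrite cos_atan, sin_atan; fold r.
  replace ((x + y) * cos t + c) with (cos t * F + sin t * N).
  - field; lra.
  - unfold F, N.
    replace (sin t * (c * sin t)) with (c * (sin t * sin t)) by ring.
    rewrite Hs; ring. }
replace (landen_angle x c y t) with (2 * (t - al))
  by (unfold landen_angle, al, N, F; ring).
rewrite cos_2a_cos, Hcos.
replace (2 * (((x + y) * cos t + c) / (F * r)) * (((x + y) * cos t + c) / (F * r)))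
  with (2 * ((x + y) * cos t + c) ^ 2 / (F ^ 2 * r ^ 2)) by (field; lra).
rewrite Hr2, HNF.
replace (F ^ 2 * (2 * (x + y) * (x + c * cos t) / F ^ 2))
  with (2 * (x + y) * (x + c * cos t)) by (field; lra).
clear - HD Hyc Hy Hc.
(* c^2 = (x - y) (x + y) turns the cosine of the half angle into D - y. *)
assert (E : (x - y) * ((x + y) * cos t + c) ^ 2 = (x + y) * (x + c * cos t - y) ^ 2).
{ apply Rmult_eq_reg_l with (x + y); [|lra].
  replace ((x + y) * ((x - y) * ((x + y) * cos t + c) ^ 2)) with
   ((x ^ 2 - y ^ 2) * ((x + y) * cos t + c) ^ 2) by ring.
  replace (x ^ 2 - y ^ 2) with (c ^ 2) by lra.
  replace ((x + y) * ((x + y) * (x + c * cos t - y) ^ 2)) with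
   ((x ^ 2 - y ^ 2 + c * cos t * (x + y)) ^ 2) by ring.
  replace (x ^ 2 - y ^ 2) with (c ^ 2) by lra. ring. }
replace ((x - y) / 4 *
  (2 * ((x + y) * cos t + c) ^ 2 / (2 * (x + y) * (x + c * cos t)) - 1))
 with ((x - y) * ((x + y) * cos t + c) ^ 2 / (4 * (x + y) * (x + c * cos t)) - (x - y) / 4)
 by (field; lra).
rewrite E; field; lra.
Qed.

Lemma landen_new_coefficients (x c y : R) :
  0 <= c < x -> 0 < y -> y ^ 2 = x ^ 2 - c ^ 2 ->
  0 <= (x - y) / 4 < (x + 3 * y) / 4.
Proof. intros; nra. Qed.

(** The change of variables by the Landen angle.  It covers [0, 2 PI] once while
    t covers [0, PI], whence the factor 2. *)
Lemma landen_substitution (g : R -> R) (x c y : R) :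
  0 <= c < x -> 0 < y -> y ^ 2 = x ^ 2 - c ^ 2 ->
  (forall z, 0 < z -> continuous g z) ->
  2 * cosint g ((x + 3 * y) / 4) ((x - y) / 4)
  = RInt (fun t => (1 + y / (x + c * cos t)) *
           g ((x + c * cos t + y) ^ 2 / (4 * (x + c * cos t)))) 0 PI.
Proof.
intros Hc Hy Hyc Hg.
pose proof (landen_new_coefficients x c y Hc Hy Hyc) as Hc'.
rewrite <- cosint_unfold_two_pi by assumption.
assert (Hend : forall t, sin t = 0 -> landen_angle x c y t = 2 * t).
{ intros t Ht; unfold landen_angle, Rdiv.
  rewrite Ht, (Rmult_0_r c), Rmult_0_l, atan_0; ring. }
rewrite <- (Hend PI sin_PI).
replace 0 with (landen_angle x c y 0) at 1 by (rewrite (Hend 0 sin_0); ring).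
rewrite <- (RInt_comp (V := R_CompleteNormedModule)
  (fun s => g ((x + 3 * y) / 4 + (x - y) / 4 * cos s))
  (landen_angle x c y) (fun t => 1 + y / (x + c * cos t))).
- apply RInt_ext; intros t _.
  rewrite landen_radicand by assumption; reflexivity.
- intros t _.
  apply (continuous_comp (fun s => (x + 3 * y) / 4 + (x - y) / 4 * cos s) g).
  + apply continuous_radicand.
  + apply Hg, radicand_pos, Hc'.
- intros t _; split.
  + now apply is_derive_landen_angle.
  + apply (ex_derive_continuous (V := R_NormedModule)); auto_derive.
    pose proof (radicand_pos x c t Hc); lra.
Qed.

Lemma sqrt_landen_radicand (D y : R) :
  0 < D -> 0 < y -> sqrt ((D + y) ^ 2 / (4 * D)) = (D + y) / (2 * sqrt D).
Proof.
intros HD Hy; pose proof (sqrt_lt_R0 D HD) as HsD.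
replace ((D + y) ^ 2 / (4 * D)) with (((D + y) / (2 * sqrt D)) ^ 2).
- apply sqrt_pow2, Rlt_le, Rdiv_lt_0_compat; lra.
- transitivity ((D + y) ^ 2 / (4 * sqrt D ^ 2)); [field; lra|].
  rewrite pow2_sqrt by lra; reflexivity.
Qed.

(** Gauss's invariance: with D = x + c cos t, the transformed integrand is
    (1 + y / D) * 2 sqrt D / (D + y) = 2 / sqrt D. *)
Lemma ellK_landen (x c y : R) :
  0 <= c < x -> 0 < y -> y ^ 2 = x ^ 2 - c ^ 2 ->
  ellK ((x + 3 * y) / 4) ((x - y) / 4) = ellK x c.
Proof.
intros Hc Hy Hyc.
pose proof (landen_substitution (fun z => / sqrt z) x c y Hc Hy Hyc
  continuous_sqrt_inv) as H.
apply Rmult_eq_reg_l with 2; [|lra].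
unfold ellK at 1; rewrite H; unfold ellK, cosint.
rewrite <- (RInt_scal (V := R_CompleteNormedModule)
  (fun t => / sqrt (x + c * cos t))).
2: apply (ex_cosint (fun z => / sqrt z)); auto using continuous_sqrt_inv.
apply RInt_ext; intros t _.
pose proof (radicand_pos x c t Hc) as HD.
rewrite sqrt_landen_radicand by assumption.
unfold scal; simpl; unfold mult; simpl.
pose proof (sqrt_lt_R0 _ HD) as Hq.
pose proof (pow2_sqrt _ (Rlt_le _ _ HD)) as Hsq.
revert Hq Hsq; generalize (sqrt (x + c * cos t)); intros q Hq Hsq.
rewrite <- Hsq; field; rewrite Hsq; lra.
Qed.

Lemma is_derive_sin_over_sqrt (x c t : R) :
  0 <= c < x ->
  is_derive (fun t => 2 * c * (sin t / sqrt (x + c * cos t))) t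
    (sqrt (x + c * cos t)
     - (x ^ 2 - c ^ 2) * / ((x + c * cos t) * sqrt (x + c * cos t))).
Proof.
intros Hc.
pose proof (radicand_pos x c t Hc) as HD.
pose proof (sqrt_lt_R0 _ HD) as HsD.
pose proof (pow2_sqrt _ (Rlt_le _ _ HD)) as Hsq.
assert (Hs : sin t * sin t = 1 - cos t * cos t).
{ pose proof (sin2_cos2 t) as H; unfold Rsqr in H; lra. }
auto_derive; [repeat split; lra|].
set (q := sqrt (x + c * cos t)) in *.
apply Rminus_diag_uniq.
match goal with |- ?l - ?r = 0 =>
 replace (l - r) with
 ((2 * c * cos t * q ^ 2 + c ^ 2 * (sin t * sin t) - q ^ 4 + (x ^ 2 - c ^ 2)
     * (q ^ 2 / (x + c * cos t))) / q ^ 3) by (field; lra) end.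
replace (q ^ 4) with ((q ^ 2) ^ 2) by ring.
rewrite Hs, Hsq; field; lra.
Qed.

(** The integrals of sqrt D and of y^2 D^(-3/2) coincide, because their
    integrands differ by the derivative of 2 c sin t / sqrt D, which vanishes at
    both endpoints.  This identity is used both for the Landen step of [ellE]
    and for the derivative of [ellK]. *)
Lemma ellE_eq_cubed (x c : R) :
  0 <= c < x ->
  is_RInt (fun t => (x ^ 2 - c ^ 2) * / ((x + c * cos t) * sqrt (x + c * cos t)))
    0 PI (ellE x c).
Proof.
intros Hc.
pose proof (is_RInt_ellE x c Hc) as HE.
pose proof (is_RInt_derive (V := R_CompleteNormedModule)
  (fun t => 2 * c * (sin t / sqrt (x + c * cos t))) _ 0 PI
  (fun t _ => is_derive_sin_over_sqrt x c t Hc)) as H0.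
pose proof (is_RInt_minus (V := R_NormedModule) _ _ _ _ _ _ HE (H0
  ltac:(intros t _; pose proof (radicand_pos x c t Hc) as HD;
        pose proof (sqrt_lt_R0 _ HD);
        apply (ex_derive_continuous (V := R_NormedModule)); auto_derive;
        repeat split; try lra; apply Rgt_not_eq, Rmult_lt_0_compat; lra))) as H.
replace (ellE x c) with (minus (ellE x c)
  (minus (2 * c * (sin PI / sqrt (x + c * cos PI)))
         (2 * c * (sin 0 / sqrt (x + c * cos 0))))).
- revert H; apply is_RInt_ext; intros t _.
  unfold minus, plus, opp; simpl; ring.
- rewrite sin_PI, sin_0; unfold minus, plus, opp, Rdiv; simpl; ring.
Qed.

(** The transformed integrand is (D + y)^2 / (2 D sqrt D), that is, one half of
    sqrt D + 2 y / sqrt D + y^2 D^(-3/2), and the last term integrates to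
    [ellE] again. *)
Lemma ellE_landen (x c y : R) :
  0 <= c < x -> 0 < y -> y ^ 2 = x ^ 2 - c ^ 2 ->
  2 * ellE ((x + 3 * y) / 4) ((x - y) / 4) = ellE x c + y * ellK x c.
Proof.
intros Hc Hy Hyc.
unfold ellE at 1.
rewrite (landen_substitution sqrt x c y Hc Hy Hyc) by auto using continuous_sqrt.
apply is_RInt_unique.
pose proof (is_RInt_ellE x c Hc) as HE.
pose proof (is_RInt_ellK x c Hc) as HK.
pose proof (is_RInt_plus (V := R_NormedModule) _ _ _ _ _ _
  (is_RInt_scal (V := R_NormedModule) _ _ _ (/ 2) _
    (is_RInt_plus (V := R_NormedModule) _ _ _ _ _ _ HE (ellE_eq_cubed x c Hc)))
  (is_RInt_scal (V := R_NormedModule) _ _ _ y _ HK)) as H.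
replace (ellE x c + y * ellK x c) with
  (plus (scal (/ 2) (plus (ellE x c) (ellE x c))) (scal y (ellK x c))).
2: unfold plus, scal; simpl; unfold mult; simpl; field.
revert H; apply is_RInt_ext; intros t _.
pose proof (radicand_pos x c t Hc) as HD.
rewrite sqrt_landen_radicand, <- Hyc by assumption.
unfold plus, scal; simpl; unfold mult; simpl.
pose proof (sqrt_lt_R0 _ HD) as Hq.
pose proof (pow2_sqrt _ (Rlt_le _ _ HD)) as Hsq.
revert Hq Hsq; generalize (sqrt (x + c * cos t)); intros q Hq Hsq.
rewrite <- Hsq; field; lra.
Qed.

(** * Derivatives in the modulus *)

Lemma is_derive_cosint (g dg : R -> R) (x c : R) :
  0 < c < x ->
  (forall z, 0 < z -> is_derive g z (dg z)) ->
  (forall z, 0 < z -> continuous dg z) ->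
  is_derive (cosint g x) c (RInt (fun t => cos t * dg (x + c * cos t)) 0 PI).
Proof.
intros Hc Hg Hdg.
assert (Hloc : locally c (fun u => 0 < u < x)).
{ apply (locally_interval _ c 0 x); simpl; try lra; auto. }
assert (Hder : forall u t, 0 < u < x ->
  is_derive (fun u => g (x + u * cos t)) u (cos t * dg (x + u * cos t))).
{ intros u t Hu.
  apply (is_derive_comp (K := R_AbsRing) (V := R_NormedModule) g
           (fun u => x + u * cos t)).
  - apply Hg, radicand_pos; lra.
  - auto_derive; [auto|ring]. }
replace (RInt (fun t => cos t * dg (x + c * cos t)) 0 PI)
  with (RInt (fun t => Derive (fun u => g (x + u * cos t)) c) 0 PI).
2: { apply RInt_ext; intros t _; apply is_derive_unique, Hder, Hc. }
apply (is_derive_RInt_param (fun u t => g (x + u * cos t)) 0 PI c).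
- revert Hloc; apply filter_imp; intros u Hu t _.
  eexists; apply Hder, Hu.
- intros t _.
  apply continuity_2d_pt_ext_loc with (fun u v => cos v * dg (x + u * cos v)).
  + destruct Hloc as [e He]; exists e; intros u v Hu _.
    symmetry; apply is_derive_unique, Hder, He, Hu.
  + assert (Hcos : continuity_2d_pt (fun _ v : R => cos v) c t).
    { apply (continuity_1d_2d_pt_comp cos (fun _ v => v)).
      - apply continuity_cos.
      - apply continuity_2d_pt_id2. }
    apply continuity_2d_pt_mult; [exact Hcos|].
    apply (continuity_1d_2d_pt_comp dg (fun u v => x + u * cos v)).
    * apply continuity_pt_filterlim, Hdg, radicand_pos; lra.
    * apply continuity_2d_pt_plus; [apply continuity_2d_pt_const|].
      apply continuity_2d_pt_mult; [apply continuity_2d_pt_id1|exact Hcos].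
- revert Hloc; apply filter_imp; intros u Hu.
  apply ex_cosint; [lra|].
  intros z Hz; apply (ex_derive_continuous (V := R_NormedModule)).
  eexists; apply Hg, Hz.
Qed.

(** Since c cos t = D - x, the differentiated integrand cos t / (2 sqrt D) is a
    combination of sqrt D and 1 / sqrt D. *)
Lemma is_derive_ellE (x c : R) :
  0 < c < x ->
  is_derive (ellE x) c ((ellE x c - x * ellK x c) / (2 * c)).
Proof.
intros Hc.
replace ((ellE x c - x * ellK x c) / (2 * c))
  with (RInt (fun t => cos t * / (2 * sqrt (x + c * cos t))) 0 PI).
- apply (is_derive_cosint sqrt (fun z => / (2 * sqrt z))); auto.
  + intros z Hz; pose proof (sqrt_lt_R0 z Hz); auto_derive; [lra|field; lra].
  + intros z Hz; pose proof (sqrt_lt_R0 z Hz).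
    apply (ex_derive_continuous (V := R_NormedModule)); auto_derive.
    repeat split; lra.
- apply is_RInt_unique.
  assert (Hc' : 0 <= c < x) by lra.
  pose proof (is_RInt_scal (V := R_NormedModule) _ _ _ (/ (2 * c)) _
    (is_RInt_minus (V := R_NormedModule) _ _ _ _ _ _ (is_RInt_ellE x c Hc')
      (is_RInt_scal (V := R_NormedModule) _ _ _ x _ (is_RInt_ellK x c Hc')))) as H.
  replace ((ellE x c - x * ellK x c) / (2 * c)) with
   (scal (/ (2 * c)) (minus (ellE x c) (scal x (ellK x c)))).
  2: unfold minus, plus, opp, scal; simpl; unfold mult; simpl; field; lra.
  revert H; apply is_RInt_ext; intros t _.
  pose proof (radicand_pos x c t Hc') as HD.
  unfold minus, plus, opp, scal; simpl; unfold mult; simpl.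
  pose proof (sqrt_lt_R0 _ HD) as Hq.
  pose proof (pow2_sqrt _ (Rlt_le _ _ HD)) as Hsq.
  replace (cos t) with ((sqrt (x + c * cos t) ^ 2 - x) / c) at 3
    by (rewrite Hsq; field; lra).
  field; lra.
Qed.

(** Here c cos t = D - x leaves a multiple of D^(-3/2), whose integral is
    [ellE x c] up to the factor x^2 - c^2. *)
Lemma is_derive_ellK (x c : R) :
  0 < c < x ->
  is_derive (ellK x) c
    ((x * ellE x c - (x ^ 2 - c ^ 2) * ellK x c) / (2 * c * (x ^ 2 - c ^ 2))).
Proof.
intros Hc.
assert (Hy : 0 < x ^ 2 - c ^ 2) by nra.
replace ((x * ellE x c - (x ^ 2 - c ^ 2) * ellK x c) / (2 * c * (x ^ 2 - c ^ 2)))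
  with (RInt (fun t => cos t * - / (2 * ((x + c * cos t) * sqrt (x + c * cos t)))) 0 PI).
- apply (is_derive_cosint (fun z => / sqrt z) (fun z => - / (2 * (z * sqrt z)))); auto.
  + intros z Hz; pose proof (sqrt_lt_R0 z Hz); auto_derive; [split; lra|].
    pose proof (pow2_sqrt z (Rlt_le _ _ Hz)) as Hsq.
    transitivity (- / (2 * (sqrt z ^ 2 * sqrt z))); [field; lra|].
    rewrite Hsq; reflexivity.
  + intros z Hz; pose proof (sqrt_lt_R0 z Hz).
    apply (ex_derive_continuous (V := R_NormedModule)); auto_derive.
    repeat split; try lra; apply Rgt_not_eq; nra.
- apply is_RInt_unique.
  assert (Hc' : 0 <= c < x) by lra.
  pose proof (is_RInt_scal (V := R_NormedModule) _ _ _ (/ (2 * c)) _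
    (is_RInt_minus (V := R_NormedModule) _ _ _ _ _ _
      (is_RInt_scal (V := R_NormedModule) _ _ _ (x / (x ^ 2 - c ^ 2)) _
         (ellE_eq_cubed x c Hc')) (is_RInt_ellK x c Hc'))) as H.
  match goal with |- is_RInt _ _ _ ?v =>
  replace v with
   (scal (/ (2 * c)) (minus (scal (x / (x ^ 2 - c ^ 2)) (ellE x c)) (ellK x c))) end.
  2: unfold minus, plus, opp, scal; simpl; unfold mult; simpl; field; lra.
  revert H; apply is_RInt_ext; intros t _.
  pose proof (radicand_pos x c t Hc') as HD.
  unfold minus, plus, opp, scal; simpl; unfold mult; simpl.
  pose proof (sqrt_lt_R0 _ HD) as Hq.
  field; repeat split; lra.
Qed.

(** * Legendre's relation *)

(** Legendre's combination for the complementary moduli sin s and cos s;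
    parametrizing them by an angle keeps the derivative symmetric. *)
Definition legendre (s : R) : R :=
  ellK 1 (sin s) * ellE 1 (cos s) + ellE 1 (sin s) * ellK 1 (cos s)
  - ellK 1 (sin s) * ellK 1 (cos s).

Lemma sin_cos_in_01 (s : R) : 0 < s < PI / 2 -> 0 < sin s < 1 /\ 0 < cos s < 1.
Proof.
intros Hs.
assert (H1 : 0 < sin s) by (apply sin_gt_0; lra).
assert (H2 : 0 < cos s) by (apply cos_gt_0; lra).
pose proof (sin2_cos2 s) as H; unfold Rsqr in H; split; nra.
Qed.

(** Inserting the derivatives of [ellK] and [ellE], everything cancels except a
    multiple of 1 - sin^2 s - cos^2 s. *)
Lemma is_derive_legendre (s : R) : 0 < s < PI / 2 -> is_derive legendre s 0.
Proof.
intros Hs; destruct (sin_cos_in_01 s Hs) as [Hu Hv].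
pose proof (is_derive_ellK 1 (sin s) Hu) as HKu.
pose proof (is_derive_ellE 1 (sin s) Hu) as HEu.
pose proof (is_derive_ellK 1 (cos s) Hv) as HKv.
pose proof (is_derive_ellE 1 (cos s) Hv) as HEv.
unfold legendre; auto_derive.
- repeat split; eexists; eassumption.
- change (fun x => ellK 1 x) with (ellK 1).
  change (fun x => ellE 1 x) with (ellE 1).
  apply is_derive_unique in HKu, HEu, HKv, HEv.
  rewrite HKu, HEu, HKv, HEv.
  assert (Hcs : 1 ^ 2 - cos s ^ 2 = sin s ^ 2).
  { pose proof (sin2_cos2 s) as H; unfold Rsqr in H; lra. }
  assert (Hsc : 1 ^ 2 - sin s ^ 2 = cos s ^ 2).
  { pose proof (sin2_cos2 s) as H; unfold Rsqr in H; lra. }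
  rewrite Hcs, Hsc.
  set (Ku := ellK 1 (sin s)); set (Kv := ellK 1 (cos s)).
  set (Eu := ellE 1 (sin s)); set (Ev := ellE 1 (cos s)).
  match goal with |- ?l = 0 => replace l with
    ((1 - sin s ^ 2 - cos s ^ 2) * (Ku * Ev - Eu * Kv) / (2 * sin s * cos s))
    by (field; lra) end.
  rewrite <- Hsc; field; lra.
Qed.

Lemma is_RInt_close (f g : R -> R) (F G e : R) :
  is_RInt f 0 PI F -> is_RInt g 0 PI G ->
  (forall t, 0 <= t <= PI -> Rabs (f t - g t) <= e) ->
  Rabs (F - G) <= PI * e.
Proof.
intros Hf Hg He; pose proof PI_RGT_0.
apply (norm_RInt_le (V := R_NormedModule) (fun t => minus (f t) (g t))
  (fun _ => e) 0 PI (minus F G) (PI * e)).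
- lra.
- exact He.
- now apply (is_RInt_minus (V := R_NormedModule)).
- replace (PI * e) with (scal (PI - 0) e)
    by (unfold scal; simpl; unfold mult; simpl; ring).
  apply (is_RInt_const (V := R_NormedModule)).
Qed.

Lemma sqrt_radicand_near_1 (u t : R) :
  0 <= u <= / 2 ->
  let q := sqrt (1 + u * cos t) in
  q ^ 2 = 1 + u * cos t /\ / 2 <= q /\ 1 <= q * (1 + q) /\ Rabs (q ^ 2 - 1) <= u.
Proof.
intros Hu q.
assert (H : q ^ 2 = 1 + u * cos t).
{ apply pow2_sqrt; pose proof (COS_bound t); nra. }
pose proof (sqrt_pos (1 + u * cos t)) as Hq; fold q in Hq.
pose proof (COS_bound t).
assert (Rabs (q ^ 2 - 1) <= u) by (rewrite H; apply Rabs_le; nra).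
assert (/ 2 <= q ^ 2) by (rewrite H; nra).
assert (/ 2 <= q) by nra.
repeat split; auto; nra.
Qed.

Lemma Rabs_inv_minus_1 (q : R) :
  0 < q -> 1 <= q * (1 + q) -> Rabs (/ q - 1) <= Rabs (q ^ 2 - 1).
Proof.
intros Hq H1.
replace (q ^ 2 - 1) with (- ((/ q - 1) * (q * (1 + q)))) by (field; lra).
rewrite Rabs_Ropp, Rabs_mult, (Rabs_right (q * (1 + q))) by lra.
pose proof (Rabs_pos (/ q - 1)); nra.
Qed.

Lemma ellK_near_0 (u : R) : 0 <= u <= / 2 -> Rabs (ellK 1 u - PI) <= PI * u.
Proof.
intros Hu.
apply (is_RInt_close (fun t => / sqrt (1 + u * cos t)) (fun _ => 1)).
- apply is_RInt_ellK; lra.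
- replace PI with (scal (PI - 0) 1) at 2
    by (unfold scal; simpl; unfold mult; simpl; ring).
  apply (is_RInt_const (V := R_NormedModule)).
- intros t _; destruct (sqrt_radicand_near_1 u t Hu) as (_ & H1 & H2 & H3).
  eapply Rle_trans; [apply Rabs_inv_minus_1|]; lra.
Qed.

(** The difference has to be of second order in u, because in [legendre_near_0]
    it is multiplied by a factor growing like 1 / u.  The first-order term
    - u cos t of the integrand 1 / sqrt D - sqrt D integrates to 0. *)
Lemma ellK_minus_ellE_near_0 (u : R) :
  0 <= u <= / 2 -> Rabs (ellK 1 u - ellE 1 u) <= PI * u ^ 2.
Proof.
intros Hu.
apply Rle_trans with (Rabs ((ellK 1 u - ellE 1 u) - 0)); [right; f_equal; ring|].
apply (is_RInt_close (fun t => / sqrt (1 + u * cos t) - sqrt (1 + u * cos t))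
  (fun t => - (u * cos t))).
- apply (is_RInt_minus (V := R_NormedModule)).
  + apply is_RInt_ellK; lra.
  + apply is_RInt_ellE; lra.
- replace 0 with (minus (- (u * sin PI)) (- (u * sin 0))) at 2
    by (rewrite sin_PI, sin_0; unfold minus, plus, opp; simpl; ring).
  apply (is_RInt_derive (V := R_CompleteNormedModule) (fun t => - (u * sin t))).
  + intros t _; auto_derive; [auto|ring].
  + intros t _; apply (ex_derive_continuous (V := R_NormedModule)).
    auto_derive; auto.
- intros t _; destruct (sqrt_radicand_near_1 u t Hu) as (H0 & H1 & H2 & H3).
  set (q := sqrt (1 + u * cos t)) in *; clearbody q.
  replace (/ q - q - - (u * cos t)) with ((/ q - 1) * - (q ^ 2 - 1)).
  + rewrite Rabs_mult, Rabs_Ropp.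
    assert (Rabs (/ q - 1) <= u).
    { eapply Rle_trans; [apply Rabs_inv_minus_1|]; lra. }
    pose proof (Rabs_pos (/ q - 1)); pose proof (Rabs_pos (q ^ 2 - 1)); nra.
  + replace (u * cos t) with (q ^ 2 - 1) by lra. field; lra.
Qed.

(** At v = 1 the integrand is sqrt (1 + cos t) = sqrt 2 cos (t / 2), which
    integrates to 2 sqrt 2; this is where the constant of Legendre's relation
    comes from. *)
Lemma ellE_near_1 (u v : R) :
  0 <= u -> 0 <= v < 1 -> u ^ 2 + v ^ 2 = 1 ->
  Rabs (ellE 1 v - 2 * sqrt 2) <= PI * u.
Proof.
intros Hu Hv Huv.
assert (Hs2 : sqrt 2 ^ 2 = 2) by (apply pow2_sqrt; lra).
pose proof (sqrt_lt_R0 2 ltac:(lra)) as Hs.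
apply (is_RInt_close (fun t => sqrt (1 + v * cos t)) (fun t => sqrt 2 * cos (t / 2))).
- apply is_RInt_ellE; lra.
- replace (2 * sqrt 2)
    with (minus (2 * sqrt 2 * sin (PI / 2)) (2 * sqrt 2 * sin (0 / 2)))
    by (rewrite sin_PI2; replace (0 / 2) with 0 by lra; rewrite sin_0;
        unfold minus, plus, opp; simpl; ring).
  apply (is_RInt_derive (V := R_CompleteNormedModule) (fun t => 2 * sqrt 2 * sin (t / 2))).
  + intros t _; auto_derive; [auto|unfold Rdiv; field].
  + intros t _; apply (ex_derive_continuous (V := R_NormedModule)).
    auto_derive; auto.
- intros t Ht.
  assert (Hc : 0 <= cos (t / 2)) by (apply cos_ge_0; lra).
  assert (Hp2 : sqrt (1 + v * cos t) ^ 2 = 1 + v * cos t).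
  { apply pow2_sqrt, Rlt_le, radicand_pos; lra. }
  pose proof (sqrt_pos (1 + v * cos t)) as Hp.
  assert (Hr2 : (sqrt 2 * cos (t / 2)) ^ 2 = 1 + cos t).
  { replace t with (2 * (t / 2)) at 2 by field.
    rewrite cos_2a_cos, Rpow_mult_distr, Hs2; ring. }
  assert (Hr : 0 <= sqrt 2 * cos (t / 2)) by (apply Rmult_le_pos; lra).
  set (p := sqrt (1 + v * cos t)) in *; set (r := sqrt 2 * cos (t / 2)) in *.
  pose proof (COS_bound t).
  (* (p - r)^2 <= |p^2 - r^2| = (1 - v) |cos t| <= 1 - v^2 = u^2. *)
  apply Rabs_le; split; nra.
Qed.

Lemma ellK_bounds (x c : R) :
  0 <= c < x -> PI / sqrt (x + c) <= ellK x c <= PI / sqrt (x - c).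
Proof.
intros Hc; pose proof PI_RGT_0 as HPI.
assert (Hcst : forall k, is_RInt (fun _ => / k) 0 PI (PI / k)).
{ intros k; replace (PI / k) with (scal (PI - 0) (/ k))
    by (unfold scal; simpl; unfold mult; simpl; unfold Rdiv; ring).
  apply (is_RInt_const (V := R_NormedModule)). }
split; (eapply is_RInt_le; [apply Rlt_le, HPI| | |]);
  try (apply Hcst); try (apply is_RInt_ellK, Hc); intros t _;
  pose proof (radicand_bounds x c t ltac:(lra)) as HD;
  (apply Rinv_le_contravar; [apply sqrt_lt_R0; lra | apply sqrt_le_1_alt; lra]).
Qed.

(** As u = sin s tends to 0, [ellK 1 u] tends to PI and [ellE 1 (cos s)] to
    2 sqrt 2.  The crude bound [ellK 1 (cos s)] = O(1 / u) replaces the true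
    logarithmic growth and suffices, its cofactor being O(u^2). *)
Lemma legendre_near_0 (s : R) :
  0 < s <= / 2 ->
  Rabs (legendre s - 2 * sqrt 2 * PI) <= PI * (4 + 5 * PI) * s.
Proof.
intros Hs; pose proof PI_RGT_0 as HPI; pose proof PI2_1.
destruct (sin_cos_in_01 s ltac:(lra)) as [Hu Hv].
assert (Hus : sin s < s) by (apply sin_lt_x; lra).
assert (Huv : sin s ^ 2 + cos s ^ 2 = 1).
{ pose proof (sin2_cos2 s) as H1; unfold Rsqr in H1; lra. }
unfold legendre; set (u := sin s) in *; set (v := cos s) in *.
pose proof (ellK_near_0 u ltac:(lra)) as H1.
pose proof (ellK_minus_ellE_near_0 u ltac:(lra)) as H2.
pose proof (ellE_near_1 u v ltac:(lra) ltac:(lra) Huv) as H3.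
pose proof (ellK_bounds 1 v ltac:(lra)) as H4.
assert (Hroot : 0 < sqrt (1 - v)) by (apply sqrt_lt_R0; lra).
assert (H5 : u / 2 <= sqrt (1 - v)).
{ rewrite <- (sqrt_pow2 (u / 2)) by lra; apply sqrt_le_1_alt; nra. }
assert (H6 : u * ellK 1 v <= 2 * PI).
{ apply Rle_trans with (u * (PI / sqrt (1 - v))); [apply Rmult_le_compat_l; lra|].
  apply Rmult_le_reg_r with (sqrt (1 - v)); [lra|].
  replace (u * (PI / sqrt (1 - v)) * sqrt (1 - v)) with (u * PI) by (field; lra).
  nra. }
assert (H7 : 0 <= ellK 1 v).
{ eapply Rle_trans; [|apply H4]; apply Rlt_le, Rdiv_lt_0_compat;
  [lra|apply sqrt_lt_R0; lra]. }
assert (Hs2 : sqrt 2 < 2) by (pose proof (sqrt_less 2); lra).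
(* The last product is the only one with an unbounded factor. *)
replace (ellK 1 u * ellE 1 v + ellE 1 u * ellK 1 v - ellK 1 u * ellK 1 v
         - 2 * sqrt 2 * PI)
  with ((ellK 1 u - PI) * ellE 1 v + PI * (ellE 1 v - 2 * sqrt 2)
         + - (ellK 1 u - ellE 1 u) * ellK 1 v) by ring.
assert (HE : Rabs (ellE 1 v) <= 4 + PI).
{ replace (ellE 1 v) with ((ellE 1 v - 2 * sqrt 2) + 2 * sqrt 2) by ring.
  eapply Rle_trans; [apply Rabs_triang|].
  pose proof (sqrt_pos 2).
  rewrite (Rabs_right (2 * sqrt 2)) by lra; nra. }
eapply Rle_trans; [apply Rabs_triang|].
eapply Rle_trans; [apply Rplus_le_compat_r, Rabs_triang|].
rewrite !Rabs_mult, Rabs_Ropp, (Rabs_right PI), (Rabs_right (ellK 1 v)) by lra.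
apply Rle_trans with (PI * u * (4 + PI) + PI * (PI * u) + PI * u * (2 * PI)); [|nra].
repeat apply Rplus_le_compat.
- apply Rmult_le_compat; auto using Rabs_pos.
- apply Rmult_le_compat_l; lra.
- apply Rle_trans with (PI * u ^ 2 * ellK 1 v); [now apply Rmult_le_compat_r|].
  replace (PI * u ^ 2 * ellK 1 v) with (PI * u * (u * ellK 1 v)) by ring.
  apply Rmult_le_compat_l; [nra|assumption].
Qed.

Lemma legendre_const (s s' : R) : 0 < s < s' -> s' < PI / 2 -> legendre s = legendre s'.
Proof.
intros H H'; apply (eq_is_derive (V := R_NormedModule)); [|lra].
intros t Ht; apply is_derive_legendre; lra.
Qed.

(** A constant that is within O(s) of 2 sqrt 2 PI for every small s equals
    it. *)
Lemma legendre_at_PI4 : legendre (PI / 4) = 2 * sqrt 2 * PI.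
Proof.
pose proof PI_RGT_0 as HPI; pose proof PI2_1.
apply Rminus_diag_uniq.
set (d := legendre (PI / 4) - 2 * sqrt 2 * PI).
set (C := PI * (4 + 5 * PI)).
assert (HC : 0 < C) by (unfold C; nra).
destruct (Req_dec d 0) as [Hd|Hd]; [exact Hd|exfalso].
apply Rabs_pos_lt in Hd.
set (s := Rmin (/ 4) (Rabs d / (2 * C))).
assert (Hd2 : 0 < Rabs d / (2 * C)) by (apply Rdiv_lt_0_compat; lra).
assert (Hs : 0 < s) by (apply Rmin_pos; lra).
pose proof (Rmin_l (/ 4) (Rabs d / (2 * C))) as Hs1.
pose proof (Rmin_r (/ 4) (Rabs d / (2 * C))) as Hs2.
fold s in Hs1, Hs2.
pose proof (legendre_near_0 s ltac:(lra)) as Hb; fold C in Hb.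
rewrite (legendre_const s (PI / 4)) in Hb by lra; fold d in Hb.
assert (C * (Rabs d / (2 * C)) = Rabs d / 2) by (field; lra).
nra.
Qed.

(** PI / 4 is the angle at which the two moduli agree, and this modulus is the
    one of the starting values 1 and 1 / root4 2. *)
Lemma legendre_self_complementary :
  2 * ellK 1 (/ sqrt 2) * ellE 1 (/ sqrt 2) - ellK 1 (/ sqrt 2) ^ 2
  = 2 * sqrt 2 * PI.
Proof.
rewrite <- legendre_at_PI4; unfold legendre; rewrite sin_PI4, cos_PI4.
replace (1 / sqrt 2) with (/ sqrt 2) by (unfold Rdiv; ring); ring.
Qed.

(** * The value of pi4 *)

Lemma root4_pos (z : R) : 0 < root4 z.
Proof. apply exp_pos. Qed.

Lemma root4_pow4 (z : R) : 0 < z -> root4 z ^ 4 = z.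
Proof.
intros Hz; unfold root4.
rewrite <- Rpower_pow by apply exp_pos.
rewrite Rpower_mult; replace (/ 4 * INR 4) with 1 by (simpl; field).
apply Rpower_1, Hz.
Qed.

(** The partial-fraction primitive of 1 / (1 + s^4), from
    1 + s^4 = (s^2 + sqrt 2 s + 1) (s^2 - sqrt 2 s + 1). *)
Definition quartic_primitive (s : R) : R :=
  (ln (s ^ 2 + sqrt 2 * s + 1) - ln (s ^ 2 - sqrt 2 * s + 1)) / (4 * sqrt 2)
  + (atan (sqrt 2 * s + 1) + atan (sqrt 2 * s - 1)) / (2 * sqrt 2).

Lemma quartic_factor_pos (s : R) :
  0 < s ^ 2 + sqrt 2 * s + 1 /\ 0 < s ^ 2 - sqrt 2 * s + 1.
Proof.
assert (Hr : sqrt 2 ^ 2 = 2) by (apply pow2_sqrt; lra).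
split; nra.
Qed.

Lemma is_derive_quartic_primitive (s : R) :
  is_derive quartic_primitive s (/ (1 + s ^ 4)).
Proof.
assert (Hr : sqrt 2 ^ 2 = 2) by (apply pow2_sqrt; lra).
pose proof (sqrt_lt_R0 2 ltac:(lra)) as Hr0.
destruct (quartic_factor_pos s) as [H1 H2].
unfold quartic_primitive; auto_derive; [lra|].
set (r := sqrt 2) in *; clearbody r.
assert (H4 : 0 < 1 + s ^ 4) by (pose proof (pow2_ge_0 (s ^ 2)); nra).
replace (1 + (r * s + 1) * ((r * s + 1) * 1))
  with (2 * (s ^ 2 + r * s + 1)) by nra.
replace (1 + (r * s + - (1)) * ((r * s + - (1)) * 1))
  with (2 * (s ^ 2 - r * s + 1)) by nra.
replace (1 + s ^ 4) with ((s ^ 2 + r * s + 1) * (s ^ 2 - r * s + 1)) by nra.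
field; lra.
Qed.

(** The behaviour at infinity, read at 1 / z: the logarithms lose a common
    ln (z^2), the arctangents are reflected by atan (1 / w) = PI / 2 - atan w,
    and what remains is continuous at z = 0. *)
Lemma filterlim_quartic_primitive :
  filterlim (fun z => quartic_primitive (/ z)) (at_right 0)
    (locally (PI / (2 * sqrt 2))).
Proof.
assert (Hr : sqrt 2 ^ 2 = 2) by (apply pow2_sqrt; lra).
pose proof (sqrt_lt_R0 2 ltac:(lra)) as Hr0.
set (Xi := fun z =>
  (ln (1 + sqrt 2 * z + z ^ 2) - ln (1 - sqrt 2 * z + z ^ 2)) / (4 * sqrt 2)
  + (PI - atan (z / (sqrt 2 + z)) - atan (z / (sqrt 2 - z))) / (2 * sqrt 2)).
apply filterlim_ext_loc with Xi.
- exists (mkposreal 1 Rlt_0_1); intros z Hz Hz0.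
  change (Rabs (z - 0) < 1) in Hz; rewrite Rminus_0_r in Hz.
  apply Rabs_def2 in Hz.
  assert (Hz1 : z < sqrt 2) by nra.
  unfold Xi, quartic_primitive.
  assert (Hz2 : 0 < z ^ 2) by nra.
  pose proof (quartic_factor_pos z) as [P1 P2].
  replace ((/ z) ^ 2 + sqrt 2 * / z + 1) with ((1 + sqrt 2 * z + z ^ 2) / z ^ 2)
    by (field; lra).
  replace ((/ z) ^ 2 - sqrt 2 * / z + 1) with ((1 - sqrt 2 * z + z ^ 2) / z ^ 2)
    by (field; lra).
  rewrite !ln_div by lra.
  replace (z / (sqrt 2 + z)) with (/ (sqrt 2 * / z + 1)) by (field; split; lra).
  replace (z / (sqrt 2 - z)) with (/ (sqrt 2 * / z - 1)) by (field; split; lra).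
  assert (H1 : 1 < sqrt 2 * / z).
  { apply Rmult_lt_reg_r with z; [lra|].
    rewrite Rmult_assoc, Rinv_l; lra. }
  rewrite !atan_inv by lra.
  field; lra.
- replace (PI / (2 * sqrt 2)) with (Xi 0).
  + apply (filterlim_filter_le_1 (F := locally 0)).
    { intros P [e He]; exists e; intros y Hy _; now apply He. }
    apply (ex_derive_continuous (V := R_NormedModule)).
    unfold Xi; auto_derive.
    repeat split; lra.
  + unfold Xi; replace (0 / (sqrt 2 + 0)) with 0 by (field; lra).
    replace (0 / (sqrt 2 - 0)) with 0 by (field; lra).
    replace (1 + sqrt 2 * 0 + 0 ^ 2) with 1 by ring.
    replace (1 - sqrt 2 * 0 + 0 ^ 2) with 1 by ring.
    rewrite atan_0; field; lra.
Qed.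

(** Its fourth power (1 - t^4) / t^4 is continuous at 1 with value 0.  The
    ratio itself is not continuous there: [root4 0] is 1, not 0. *)
Lemma filterlim_root4_ratio :
  filterlim (fun t => root4 (1 - t ^ 4) / t) (at_left 1) (at_right 0).
Proof.
intros P [e He].
assert (He4 : 0 < e ^ 4) by (apply pow_lt, cond_pos).
assert (Hc : continuous (fun t => (1 - t ^ 4) / t ^ 4) 1).
{ apply (ex_derive_continuous (V := R_NormedModule)); auto_derive.
  lra. }
specialize (Hc (fun y => Rabs y < e ^ 4)).
destruct Hc as [d Hd].
{ exists (mkposreal _ He4); intros y Hy.
  change (Rabs (y - (1 - 1 ^ 4) / 1 ^ 4) < e ^ 4) in Hy.
  replace ((1 - 1 ^ 4) / 1 ^ 4) with 0 in Hy by field.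
  rewrite Rminus_0_r in Hy; exact Hy. }
assert (Hm : 0 < Rmin d 1) by (apply Rmin_pos; [apply cond_pos|lra]).
exists (mkposreal _ Hm); intros t Ht Ht1.
change (Rabs (t - 1) < Rmin d 1) in Ht.
pose proof (Rmin_l d 1); pose proof (Rmin_r d 1).
assert (Hdt : Rabs ((1 - t ^ 4) / t ^ 4) < e ^ 4).
{ apply Hd; change (Rabs (t - 1) < d); lra. }
apply Rabs_def2 in Ht.
assert (Ht0 : 0 < t) by lra.
assert (H4 : 0 < 1 - t ^ 4).
{ assert (t ^ 2 < 1) by nra; replace (t ^ 4) with (t ^ 2 * t ^ 2) by ring; nra. }
pose proof (root4_pos (1 - t ^ 4)) as Hr.
set (z := root4 (1 - t ^ 4) / t) in *.
assert (Hz : 0 < z) by (now apply Rdiv_lt_0_compat).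
apply He; [|exact Hz].
change (Rabs (z - 0) < e); rewrite Rminus_0_r, Rabs_right by lra.
replace ((1 - t ^ 4) / t ^ 4) with (z ^ 4) in Hdt.
- rewrite Rabs_right in Hdt by (apply Rle_ge, pow_le; lra).
  apply Rnot_le_lt; intros Hle.
  assert (e ^ 4 <= z ^ 4) by (apply pow_incr; pose proof (cond_pos e); lra).
  lra.
- transitivity (root4 (1 - t ^ 4) ^ 4 / t ^ 4); [unfold z; field; lra|].
  rewrite root4_pow4 by exact H4; reflexivity.
Qed.

(** The substitution s = t / root4 (1 - t^4) has derivative
    1 / (root4 (1 - t^4) (1 - t^4)), and 1 / (1 + s^4) = 1 - t^4. *)
Lemma is_derive_pi4_primitive (t : R) :
  t ^ 4 < 1 ->
  is_derive (fun t => quartic_primitive (t / root4 (1 - t ^ 4))) t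
    (/ root4 (1 - t ^ 4)).
Proof.
intros Ht.
pose proof (root4_pos (1 - t ^ 4)) as Hr.
pose proof (root4_pow4 (1 - t ^ 4) ltac:(lra)) as Hr4.
replace (/ root4 (1 - t ^ 4)) with
  (scal (/ (root4 (1 - t ^ 4) * (1 - t ^ 4)))
        (/ (1 + (t / root4 (1 - t ^ 4)) ^ 4))).
- apply (is_derive_comp (K := R_AbsRing) (V := R_NormedModule) quartic_primitive
    (fun t => t / root4 (1 - t ^ 4))).
  + apply is_derive_quartic_primitive.
  + unfold root4, Rpower in *; auto_derive;
    replace (1 + - (t * (t * (t * (t * 1))))) with (1 - t ^ 4) by ring.
    * repeat split; lra.
    * revert Hr; generalize (exp (/ 4 * ln (1 - t ^ 4))); intros q Hr.
      field; split; lra.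
- match goal with |- scal ?a ?b = ?d => change (a * b = d :> R) end.
  replace (1 + (t / root4 (1 - t ^ 4)) ^ 4) with (/ (1 - t ^ 4)).
  + field; split; lra.
  + transitivity (1 + t ^ 4 / root4 (1 - t ^ 4) ^ 4).
    * rewrite Hr4; field; lra.
    * field; lra.
Qed.

Lemma pow4_lt_1 (t : R) : 0 <= t < 1 -> t ^ 4 < 1.
Proof.
intros Ht; assert (0 <= t ^ 2 < 1) by nra.
replace (t ^ 4) with (t ^ 2 * t ^ 2) by ring; nra.
Qed.

Lemma pi4_eq : pi4 = PI / sqrt 2.
Proof.
pose proof (sqrt_lt_R0 2 ltac:(lra)) as Hr0.
replace (PI / sqrt 2) with (2 * (PI / (2 * sqrt 2))) by (field; lra).
unfold pi4; f_equal.
apply (is_RInt_gen_unique (V := R_CompleteNormedModule)).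
set (Psi := fun t => quartic_primitive (t / root4 (1 - t ^ 4))).
assert (Hlim : filterlim Psi (at_left 1) (locally (PI / (2 * sqrt 2)))).
{ apply filterlim_ext with
    (fun t => quartic_primitive (/ (root4 (1 - t ^ 4) / t))).
  - intros t; unfold Psi, Rdiv; rewrite Rinv_mult, Rinv_inv.
    f_equal; ring.
  - apply filterlim_comp with (2 := filterlim_quartic_primitive).
    exact filterlim_root4_ratio. }
assert (H0 : Psi 0 = 0).
{ unfold Psi, quartic_primitive, Rdiv; rewrite Rmult_0_l, Rmult_0_r.
  replace (0 + -1) with (-1) by ring.
  replace (0 ^ 2 + 0) with 0 by ring.
  replace (0 ^ 2 - 0) with 0 by ring.
  replace (0 - 1) with (- (0 + 1)) by ring; rewrite atan_opp; ring. }
intros P HP.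
apply Filter_prod with (fun a => a = 0) (fun b => 0 < b < 1 /\ P (Psi b)).
- reflexivity.
- apply filter_and; [|exact (Hlim P HP)].
  exists (mkposreal 1 Rlt_0_1); intros b Hb Hb1.
  change (Rabs (b - 1) < 1) in Hb; apply Rabs_def2 in Hb; lra.
- intros a b -> [Hb HPb]; exists (Psi b); split; [|exact HPb]; simpl.
  replace (Psi b) with (minus (Psi b) (Psi 0))
    by (rewrite H0; unfold minus, plus, opp; simpl; ring).
  apply (is_RInt_derive (V := R_CompleteNormedModule) Psi).
  + intros t; rewrite Rmin_left, Rmax_right by lra; intros Ht.
    apply is_derive_pi4_primitive, pow4_lt_1; lra.
  + intros t; rewrite Rmin_left, Rmax_right by lra; intros Ht.
    pose proof (pow4_lt_1 t ltac:(lra)) as H4.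
    pose proof (root4_pos (1 - t ^ 4)) as Hr.
    apply (ex_derive_continuous (V := R_NormedModule)).
    unfold root4, Rpower in *; auto_derive.
    replace (1 + - (t * (t * (t * (t * 1))))) with (1 - t ^ 4) by ring.
    repeat split; lra.
Qed.

(** * Convergence of the means *)

Lemma mean4_step (a b : R) (n : nat) :
  0 < a -> 0 < b ->
  mean4_a a b (S n) ^ 2 = (mean4_a a b n ^ 2 + 3 * mean4_b a b n ^ 2) / 4 /\
  mean4_b a b (S n) ^ 4
  = (mean4_a a b n ^ 2 + mean4_b a b n ^ 2) * mean4_b a b n ^ 2 / 2.
Proof.
intros Ha Hb; destruct (mean4_pos a b n Ha Hb) as [HA HB]; revert HA HB.
unfold mean4_a, mean4_b; cbn [mean4].
destruct (mean4 a b n) as [x y]; cbn [fst snd]; intros HA HB.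
pose proof (pow_lt x 2 HA); pose proof (pow_lt y 2 HB); split.
- apply pow2_sqrt; lra.
- apply root4_pow4; nra.
Qed.

(** The c for which [mean4_a]^2, [mean4_b]^2 and c are x, y and
    c = sqrt (x^2 - y^2) of the elliptic integrals; the terms of the series are
    2^(n+1) times it. *)
Definition mean4_c (a b : R) (n : nat) : R :=
  sqrt (mean4_a a b n ^ 4 - mean4_b a b n ^ 4).

(** With x = a_n^2 and y = b_n^2, this is
    ((x + 3 y) / 4)^2 - (x + y) y / 2 = ((x - y) / 4)^2: the difference of
    fourth powers becomes a perfect square. *)
Lemma mean4_step_diff (a b : R) (n : nat) :
  0 < a -> 0 < b ->
  mean4_a a b (S n) ^ 4 - mean4_b a b (S n) ^ 4
  = ((mean4_a a b n ^ 2 - mean4_b a b n ^ 2) / 4) ^ 2.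
Proof.
intros Ha Hb; destruct (mean4_step a b n Ha Hb) as [H1 H2].
replace (mean4_a a b (S n) ^ 4) with ((mean4_a a b (S n) ^ 2) ^ 2) by ring.
rewrite H1, H2; field.
Qed.

Lemma mean4_order (a b : R) (n : nat) :
  0 < b -> b <= a -> mean4_b a b n <= mean4_a a b n.
Proof.
intros Hb Hab; destruct n as [|n]; [exact Hab|].
destruct (mean4_pos a b (S n) ltac:(lra) Hb) as [HA HB].
pose proof (mean4_step_diff a b n ltac:(lra) Hb) as H.
pose proof (pow2_ge_0 ((mean4_a a b n ^ 2 - mean4_b a b n ^ 2) / 4)) as H0.
set (x := mean4_a a b (S n)) in *; set (y := mean4_b a b (S n)) in *.
apply Rnot_lt_le; intros Hlt.
assert (x ^ 2 < y ^ 2) by nra.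
assert (0 < x ^ 2) by nra.
replace (x ^ 4) with (x ^ 2 * x ^ 2) in H by ring.
replace (y ^ 4) with (y ^ 2 * y ^ 2) in H by ring.
nra.
Qed.

Lemma mean4_sq_order (a b : R) (n : nat) :
  0 < b -> b <= a -> 0 < mean4_b a b n ^ 2 <= mean4_a a b n ^ 2.
Proof.
intros Hb Hab; pose proof (mean4_order a b n Hb Hab).
destruct (mean4_pos a b n ltac:(lra) Hb); nra.
Qed.

Lemma mean4_a_decr (a b : R) (n : nat) :
  0 < b -> b <= a -> mean4_a a b (S n) <= mean4_a a b n.
Proof.
intros Hb Hab; pose proof (mean4_sq_order a b n Hb Hab).
destruct (mean4_step a b n ltac:(lra) Hb) as [H1 _].
destruct (mean4_pos a b n ltac:(lra) Hb); destruct (mean4_pos a b (S n) ltac:(lra) Hb).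
apply Rnot_lt_le; intros Hlt; nra.
Qed.

Lemma mean4_b_ge (a b : R) (n : nat) :
  0 < b -> b <= a -> b <= mean4_b a b n.
Proof.
intros Hb Hab; induction n as [|n IH]; [right; reflexivity|].
apply Rle_trans with (1 := IH).
pose proof (mean4_sq_order a b n Hb Hab) as Ho.
destruct (mean4_step a b n ltac:(lra) Hb) as [_ H2].
destruct (mean4_pos a b n ltac:(lra) Hb) as [_ HB].
destruct (mean4_pos a b (S n) ltac:(lra) Hb) as [_ HB'].
set (y := mean4_b a b n) in *; set (y' := mean4_b a b (S n)) in *.
apply Rnot_lt_le; intros Hlt.
assert (0 < y' ^ 2 < y ^ 2) by nra.
replace (y' ^ 4) with (y' ^ 2 * y' ^ 2) in H2 by ring.
nra.
Qed.

(** With x' and y' the next squares, (x' - y') (x' + y') = ((x - y) / 4)^2 and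
    x' + y' >= (x - y) / 4, so each step divides the gap by at least 4.  This
    beats the weights 2^n of the series. *)
Lemma mean4_sq_gap (a b : R) (n : nat) :
  0 < b -> b <= a ->
  0 <= mean4_a a b n ^ 2 - mean4_b a b n ^ 2 <= (a ^ 2 - b ^ 2) * (/ 4) ^ n.
Proof.
intros Hb Hab; split; [pose proof (mean4_sq_order a b n Hb Hab); lra|].
induction n as [|n IH].
{ change (mean4_a a b 0) with a; change (mean4_b a b 0) with b; simpl; lra. }
pose proof (mean4_sq_order a b n Hb Hab) as H.
pose proof (mean4_sq_order a b (S n) Hb Hab) as H'.
destruct (mean4_step a b n ltac:(lra) Hb) as [H1 _].
pose proof (mean4_step_diff a b n ltac:(lra) Hb) as H2.
replace (mean4_a a b (S n) ^ 4) with ((mean4_a a b (S n) ^ 2) ^ 2) in H2 by ring.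
replace (mean4_b a b (S n) ^ 4) with ((mean4_b a b (S n) ^ 2) ^ 2) in H2 by ring.
apply Rle_trans with ((mean4_a a b n ^ 2 - mean4_b a b n ^ 2) / 4).
2: { replace ((/ 4) ^ S n) with (/ 4 * (/ 4) ^ n) by reflexivity; lra. }
revert H H' H1 H2; clear IH.
generalize (mean4_a a b (S n) ^ 2), (mean4_b a b (S n) ^ 2),
  (mean4_a a b n ^ 2), (mean4_b a b n ^ 2); intros x' y' x y H H' H1 H2.
apply Rmult_le_reg_r with (x' + y'); [lra|].
replace ((x' - y') * (x' + y')) with (x' ^ 2 - y' ^ 2) by ring.
rewrite H2; nra.
Qed.

Lemma is_lim_seq_geom_bound (u : nat -> R) (C q : R) :
  Rabs q < 1 -> (forall n, 0 <= u n <= C * q ^ n) -> is_lim_seq u 0.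
Proof.
intros Hq Hu.
apply is_lim_seq_le_le with (u := fun _ => 0) (w := fun n => C * q ^ n).
- exact Hu.
- apply is_lim_seq_const.
- replace (Finite 0) with (Rbar_mult C 0) by (simpl; f_equal; ring).
  apply is_lim_seq_scal_l, is_lim_seq_geom, Hq.
Qed.

Lemma mean4_converges (a b : R) :
  0 < b -> b <= a ->
  is_lim_seq (mean4_a a b) (M4 a b) /\ is_lim_seq (mean4_b a b) (M4 a b).
Proof.
intros Hb Hab.
assert (HA : is_lim_seq (mean4_a a b) (M4 a b)).
{ apply Lim_seq_correct', (ex_finite_lim_seq_decr _ b).
  - intros n; now apply mean4_a_decr.
  - intros n; apply Rle_trans with (mean4_b a b n).
    + now apply mean4_b_ge.
    + now apply mean4_order. }
split; [exact HA|].
assert (HD : is_lim_seq (fun n => mean4_a a b n - mean4_b a b n) 0).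
{ apply is_lim_seq_geom_bound with ((a ^ 2 - b ^ 2) / b) (/ 4).
  - rewrite Rabs_right; lra.
  - intros n; pose proof (mean4_order a b n Hb Hab).
    pose proof (mean4_b_ge a b n Hb Hab).
    pose proof (mean4_sq_gap a b n Hb Hab) as [_ Hg].
    split; [lra|].
    apply Rmult_le_reg_r with b; [lra|].
    replace ((a ^ 2 - b ^ 2) / b * (/ 4) ^ n * b)
      with ((a ^ 2 - b ^ 2) * (/ 4) ^ n) by (field; lra).
    nra. }
apply is_lim_seq_ext with (fun n => mean4_a a b n - (mean4_a a b n - mean4_b a b n)).
- intros n; ring.
- replace (Finite (M4 a b)) with (Finite (M4 a b - 0)) by (f_equal; ring).
  now apply is_lim_seq_minus'.
Qed.

(** * The means and the elliptic integrals *)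

Lemma mean4_c_S (a b : R) (n : nat) :
  0 < b -> b <= a ->
  mean4_c a b (S n) = (mean4_a a b n ^ 2 - mean4_b a b n ^ 2) / 4.
Proof.
intros Hb Hab; unfold mean4_c; rewrite mean4_step_diff by lra.
apply sqrt_pow2; pose proof (mean4_sq_order a b n Hb Hab); lra.
Qed.

Lemma mean4_c_spec (a b : R) (n : nat) :
  0 < b -> b <= a ->
  0 <= mean4_c a b n < mean4_a a b n ^ 2 /\
  (mean4_b a b n ^ 2) ^ 2 = (mean4_a a b n ^ 2) ^ 2 - mean4_c a b n ^ 2.
Proof.
intros Hb Hab; pose proof (mean4_sq_order a b n Hb Hab) as H.
assert (Hc : mean4_c a b n ^ 2 = (mean4_a a b n ^ 2) ^ 2 - (mean4_b a b n ^ 2) ^ 2).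
{ unfold mean4_c; rewrite pow2_sqrt; [ring|].
  replace (mean4_a a b n ^ 4) with ((mean4_a a b n ^ 2) ^ 2) by ring.
  replace (mean4_b a b n ^ 4) with ((mean4_b a b n ^ 2) ^ 2) by ring. nra. }
assert (H0 : 0 <= mean4_c a b n) by apply sqrt_pos.
repeat split; nra.
Qed.

(** The iteration is the Landen transformation in the parameters x, y, c. *)
Lemma ellKE_mean4_step (a b : R) (n : nat) :
  0 < b -> b <= a ->
  ellK (mean4_a a b (S n) ^ 2) (mean4_c a b (S n))
  = ellK (mean4_a a b n ^ 2) (mean4_c a b n) /\
  2 * ellE (mean4_a a b (S n) ^ 2) (mean4_c a b (S n))
  = ellE (mean4_a a b n ^ 2) (mean4_c a b n)
    + mean4_b a b n ^ 2 * ellK (mean4_a a b n ^ 2) (mean4_c a b n).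
Proof.
intros Hb Hab.
destruct (mean4_c_spec a b n Hb Hab) as [Hc Hy].
pose proof (mean4_sq_order a b n Hb Hab) as H.
destruct (mean4_step a b n ltac:(lra) Hb) as [-> _].
rewrite mean4_c_S by assumption.
split; [apply ellK_landen | apply ellE_landen]; auto; apply H.
Qed.

Lemma ellK_mean4 (a b : R) (n : nat) :
  0 < b -> b <= a ->
  ellK (mean4_a a b n ^ 2) (mean4_c a b n) = ellK (a ^ 2) (mean4_c a b 0).
Proof.
intros Hb Hab; induction n as [|n IH]; [reflexivity|].
rewrite <- IH; now apply ellKE_mean4_step.
Qed.

Lemma is_lim_seq_mean4_c (a b : R) :
  0 < b -> b <= a -> is_lim_seq (mean4_c a b) 0.
Proof.
intros Hb Hab; apply is_lim_seq_incr_1.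
apply is_lim_seq_geom_bound with ((a ^ 2 - b ^ 2) / 4) (/ 4).
- rewrite Rabs_right; lra.
- intros n; rewrite mean4_c_S by assumption.
  pose proof (mean4_sq_gap a b n Hb Hab); lra.
Qed.

Lemma ellK_pos (x c : R) : 0 <= c < x -> 0 < ellK x c.
Proof.
intros Hc; eapply Rlt_le_trans; [|apply ellK_bounds, Hc].
apply Rdiv_lt_0_compat; [apply PI_RGT_0|apply sqrt_lt_R0; lra].
Qed.

(** That is, [ellK] = PI / [M4]: the invariant value of [ellK] lies between
    PI / sqrt (x + c) and PI / sqrt (x - c) at every step, while c tends to 0
    and x to the square of [M4].  Squares avoid dividing by the limit. *)
Lemma ellK_M4 (a b : R) :
  0 < b -> b <= a -> ellK (a ^ 2) (mean4_c a b 0) ^ 2 * M4 a b ^ 2 = PI ^ 2.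
Proof.
intros Hb Hab; set (K := ellK (a ^ 2) (mean4_c a b 0)).
destruct (mean4_converges a b Hb Hab) as [HA _].
pose proof (is_lim_seq_mean4_c a b Hb Hab) as Hc.
assert (HA2 : is_lim_seq (fun n => mean4_a a b n ^ 2) (M4 a b ^ 2)).
{ apply is_lim_seq_ext with (fun n => mean4_a a b n * mean4_a a b n).
  - intros n; ring.
  - replace (M4 a b ^ 2) with (M4 a b * M4 a b) by ring.
    now apply is_lim_seq_mult'. }
assert (Hlim : forall e, is_lim_seq
   (fun n => K ^ 2 * (mean4_a a b n ^ 2 + e * mean4_c a b n)) (K ^ 2 * M4 a b ^ 2)).
{ intros e.
  replace (Finite (K ^ 2 * M4 a b ^ 2))
    with (Finite (K ^ 2 * (M4 a b ^ 2 + e * 0))) by (f_equal; ring).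
  apply is_lim_seq_mult'; [apply is_lim_seq_const|].
  apply is_lim_seq_plus'; [exact HA2|].
  apply is_lim_seq_mult'; [apply is_lim_seq_const|exact Hc]. }
assert (Hbd : forall n, K ^ 2 * (mean4_a a b n ^ 2 + -1 * mean4_c a b n) <= PI ^ 2
   <= K ^ 2 * (mean4_a a b n ^ 2 + 1 * mean4_c a b n)).
{ intros n; destruct (mean4_c_spec a b n Hb Hab) as [Hcn _].
  pose proof (ellK_bounds _ _ Hcn) as HK; pose proof (ellK_pos _ _ Hcn) as HK0.
  rewrite ellK_mean4 in HK, HK0 by assumption; fold K in HK, HK0.
  pose proof PI_RGT_0.
  set (x := mean4_a a b n ^ 2) in *; set (c := mean4_c a b n) in *.
  replace (x + -1 * c) with (sqrt (x - c) ^ 2) by (rewrite pow2_sqrt; lra).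
  replace (x + 1 * c) with (sqrt (x + c) ^ 2) by (rewrite pow2_sqrt; lra).
  pose proof (sqrt_lt_R0 (x - c) ltac:(lra)) as Hp.
  pose proof (sqrt_lt_R0 (x + c) ltac:(lra)) as Hq.
  rewrite <- !Rpow_mult_distr.
  destruct HK as [HK1 HK2]; split; apply pow_incr; split.
  - nra.
  - apply Rmult_le_compat_r with (r := sqrt (x - c)) in HK2; [|lra].
    replace (PI / sqrt (x - c) * sqrt (x - c)) with PI in HK2 by (field; lra).
    exact HK2.
  - lra.
  - apply Rmult_le_compat_r with (r := sqrt (x + c)) in HK1; [|lra].
    replace (PI / sqrt (x + c) * sqrt (x + c)) with PI in HK1 by (field; lra).
    exact HK1. }
apply Rle_antisym.
- apply (is_lim_seq_le _ _ _ _ (fun n => proj1 (Hbd n)) (Hlim (-1))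
    (is_lim_seq_const (PI ^ 2))).
- apply (is_lim_seq_le _ _ _ _ (fun n => proj2 (Hbd n))
    (is_lim_seq_const (PI ^ 2)) (Hlim 1)).
Qed.

Lemma ellE_between (x c : R) :
  0 <= c < x -> (x - c) * ellK x c <= ellE x c <= (x + c) * ellK x c.
Proof.
intros Hc; pose proof PI_RGT_0 as HPI.
assert (H : forall k, is_RInt (fun t => k * / sqrt (x + c * cos t)) 0 PI (k * ellK x c)).
{ intros k; apply (is_RInt_scal (V := R_NormedModule)), is_RInt_ellK, Hc. }
split; (eapply is_RInt_le; [apply Rlt_le, HPI| | |]);
  try apply H; try (apply is_RInt_ellE, Hc); intros t _;
  pose proof (radicand_bounds x c t ltac:(lra)) as HD;
  pose proof (sqrt_lt_R0 (x + c * cos t) ltac:(lra)) as Hq;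
  apply Rmult_le_reg_r with (sqrt (x + c * cos t)); auto;
  rewrite Rmult_assoc, Rinv_l, sqrt_sqrt by lra; lra.
Qed.

(** The defect T = x K - E satisfies T_n = 2 c_(n+1) K + 2 T_(n+1) by the Landen
    step, so that the weighted terms of the series telescope. *)
Lemma sum_defect (a b : R) (n : nat) :
  0 < b -> b <= a ->
  let K := ellK (a ^ 2) (mean4_c a b 0) in
  let T k := mean4_a a b k ^ 2 * K - ellE (mean4_a a b k ^ 2) (mean4_c a b k) in
  sum_n (fun k => defect_term a b (S k)) n * K = 2 * T O - 2 ^ S (S n) * T (S n).
Proof.
intros Hb Hab K T.
assert (Hstep : forall k, defect_term a b (S k) * K
                 = 2 ^ S k * T k - 2 ^ S (S k) * T (S k)).
{ intros k.
  change (defect_term a b (S k)) with (2 ^ (S k + 1) * mean4_c a b (S k)).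
  destruct (mean4_step a b k ltac:(lra) Hb) as [H1 _].
  destruct (ellKE_mean4_step a b k Hb Hab) as [_ H2].
  rewrite (ellK_mean4 a b k Hb Hab) in H2; fold K in H2.
  unfold T; rewrite mean4_c_S by assumption; rewrite mean4_c_S in H2 by assumption.
  rewrite H1 in *.
  rewrite pow_add; simpl pow at 2.
  replace (2 ^ S (S k)) with (2 ^ S k * 2) by (simpl; ring).
  (* Rewrite only the multiple 2 E' that the Landen step evaluates. *)
  set (E' := ellE _ _) in H2 at 1; fold E'.
  replace (2 ^ S k * 2 * (_ * K - E')) with
   (2 ^ S k * (2 * ((mean4_a a b k ^ 2 + 3 * mean4_b a b k ^ 2) / 4 * K) - 2 * E')) by ring.
  rewrite H2; field. }
induction n as [|n IH].
- rewrite sum_O, Hstep; ring.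
- rewrite sum_Sn; unfold plus; simpl.
  rewrite Rmult_plus_distr_r, IH, Hstep; simpl; ring.
Qed.

(** The remainder 2^n T_n of the telescoping sum vanishes because
    |T_n| <= c_n K and c_n decays like 4^(-n). *)
Lemma is_series_defect (a b : R) :
  0 < b -> b <= a ->
  is_series (fun k => defect_term a b (S k))
    (2 * (a ^ 2 - ellE (a ^ 2) (mean4_c a b 0) / ellK (a ^ 2) (mean4_c a b 0))).
Proof.
intros Hb Hab.
set (K := ellK (a ^ 2) (mean4_c a b 0)).
assert (HK : 0 < K).
{ apply ellK_pos, (proj1 (mean4_c_spec a b 0 Hb Hab)). }
set (T := fun k => mean4_a a b k ^ 2 * K - ellE (mean4_a a b k ^ 2) (mean4_c a b k)).
assert (HT : is_lim_seq (fun n => 2 ^ S (S n) * T (S n)) 0).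
{ apply is_lim_seq_abs_0.
  apply is_lim_seq_geom_bound with ((a ^ 2 - b ^ 2) * K) (/ 2).
  - rewrite Rabs_right; lra.
  - intros n; split; [apply Rabs_pos|].
    assert (HTn : Rabs (T (S n)) <= mean4_c a b (S n) * K).
    { pose proof (ellE_between _ _ (proj1 (mean4_c_spec a b (S n) Hb Hab))) as H.
      rewrite ellK_mean4 in H by assumption; fold K in H.
      unfold T; apply Rabs_le; lra. }
    rewrite mean4_c_S in HTn by assumption.
    pose proof (mean4_sq_gap a b n Hb Hab) as [_ Hg].
    assert (H2 : 0 < 2 ^ n) by (apply pow_lt; lra).
    rewrite Rabs_mult, Rabs_right by (apply Rle_ge, pow_le; lra).
    apply Rle_trans with (2 ^ S (S n) * ((a ^ 2 - b ^ 2) * (/ 4) ^ n / 4 * K)).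
    + apply Rmult_le_compat_l; [simpl; lra|].
      apply Rle_trans with (1 := HTn), Rmult_le_compat_r; lra.
    + right; replace (/ 2) with (2 * / 4) by field.
      rewrite Rpow_mult_distr; simpl; field. }
change (is_lim_seq (sum_n (fun k => defect_term a b (S k)))
  (2 * (a ^ 2 - ellE (a ^ 2) (mean4_c a b 0) / K))).
apply is_lim_seq_ext with (fun n => (2 * T O - 2 ^ S (S n) * T (S n)) / K).
- intros n; unfold T, K; rewrite <- sum_defect by assumption; fold K.
  field; lra.
- replace (Finite (2 * (a ^ 2 - ellE (a ^ 2) (mean4_c a b 0) / K)))
    with (Finite ((2 * T O - 0) / K)).
  + apply is_lim_seq_div'; [|apply is_lim_seq_const|lra].
    apply is_lim_seq_minus'; [apply is_lim_seq_const|exact HT].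
  + f_equal; unfold T; change (mean4_a a b 0) with a; field; lra.
Qed.

(** * The representation of pi4 *)

Theorem theorem1p1 :
  (forall a b : R, 0 < b -> b <= a ->
     is_lim_seq (mean4_a a b) (Finite (M4 a b)) /\
     is_lim_seq (mean4_b a b) (Finite (M4 a b))) /\
  (ex_series (fun k : nat => defect_term 1 (1 / root4 2) (S k)) /\
   1 - Series (fun k : nat => defect_term 1 (1 / root4 2) (S k)) <> 0 /\
   pi4 = 2 * M4 1 (1 / root4 2) ^ 2 /
         (1 - Series (fun k : nat => defect_term 1 (1 / root4 2) (S k)))).
Proof.
split; [exact mean4_converges|].
set (b := 1 / root4 2).
pose proof (root4_pos 2) as Hr.
pose proof (root4_pow4 2 ltac:(lra)) as Hr4.
assert (Hb4 : b ^ 4 = / 2) by (rewrite <- Hr4; unfold b; field; lra).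
assert (Hb : 0 < b) by (apply Rdiv_lt_0_compat; lra).
assert (Hb1 : b <= 1).
{ apply Rnot_lt_le; intros Hlt.
  pose proof (pow_R1_Rle b 4 ltac:(lra)); lra. }
assert (Hc : mean4_c 1 b 0 = / sqrt 2).
{ unfold mean4_c; change (mean4_a 1 b 0) with 1; change (mean4_b 1 b 0) with b.
  rewrite Hb4, <- sqrt_inv; f_equal; field. }
pose proof (is_series_defect 1 b Hb Hb1) as HS.
pose proof (ellK_M4 1 b Hb Hb1) as HM.
pose proof (ellK_pos _ _ (proj1 (mean4_c_spec 1 b 0 Hb Hb1))) as HK.
change (mean4_a 1 b 0) with 1 in HK.
rewrite Hc, pow1 in HS, HM, HK.
pose proof legendre_self_complementary as HL.
set (K := ellK 1 (/ sqrt 2)) in *; set (E := ellE 1 (/ sqrt 2)) in *.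
pose proof PI_RGT_0 as HPI; pose proof (sqrt_lt_R0 2 ltac:(lra)) as Hs.
assert (Hs2 : sqrt 2 ^ 2 = 2) by (apply pow2_sqrt; lra).
rewrite (is_series_unique _ _ HS).
(* 1 - S = (2 E - K) / K, whose numerator is Legendre's relation over K. *)
replace (1 - 2 * (1 - E / K)) with (2 * sqrt 2 * PI / K ^ 2)
  by (rewrite <- HL; field; lra).
assert (Hden : 0 < 2 * sqrt 2 * PI / K ^ 2).
{ apply Rdiv_lt_0_compat; [nra|apply pow_lt, HK]. }
split; [eexists; exact HS|split; [lra|]].
rewrite pi4_eq.
replace (M4 1 b ^ 2) with (PI ^ 2 / K ^ 2) by (rewrite <- HM; field; lra).
field; lra.
Qed.
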